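(* If $\mathbb{E}_G\varepsilon_1^3<\infty$, then for all $h\ge0$, $$|\hat h_n^{\mathrm{OLS}}|\xrightarrow{p}\infty\qquad\text{under }\mathbb{P}_{1-h/n^2},$$ i.e. for every $K<\infty$, $\lim_{n\to\infty}\mathbb{P}_{1-h/n^2}\{|\hat h_n^{\mathrm{OLS}}|>K\}=1$, where $$\hat h_n^{\mathrm{OLS}}=-\frac{n^2\sum_{t=1}^nX_{t-1}(X_t-X_{t-1}-\mu_G)}{\sum_{t=1}^nX_{t-1}^2}.$$
   Context: Notation: $\mathbb{N}=\{1,2,\ldots\}$, $\mathbb{Z}_+=\mathbb{N}\cup\{0\}$. $G$ is a (known) probability distribution on $\mathbb{Z}_+$ with mean $\mu_G$. For $\theta\in[0,1]$, under $\mathbb{P}_\theta=\mathbb{P}_{\theta,G}$ the INAR(1) process $(X_t)_{t\ge0}$ is defined by $X_0=0$ and $X_t=\vartheta\circ X_{t-1}+\varepsilon_t$ for $t\in\mathbb{N}$, where $\vartheta\circ X_{t-1}=\sum_{j=1}^{X_{t-1}}Z^{(t)}_j$ (an empty sum is $0$), $(Z^{(t)}_j)_{j,t\in\mathbb{N}}$ are i.i.d. Bernoulli variables with success probability $\theta$, and, independently of these, $(\varepsilon_t)_{t\in\mathbb{N}}$ are i.i.d. with distribution $G$; $\mathbb{E}_G$ denotes expectation when $\varepsilon_1$ has distribution $G$. For fixed $h$ one considers $n$ large enough that $1-h/n^2\in[0,1]$. $\hat h_n^{\mathrm{OLS}}$ is the ordinary least squares estimator of $h$ when the autoregression parameter is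 $\theta_n=1-h/n^2$; equivalently $\hat h_n^{\mathrm{OLS}}=n^2(1-\hat\theta_n^{\mathrm{OLS}})$ with $\hat\theta_n^{\mathrm{OLS}}=\sum_{t=1}^nX_{t-1}(X_t-\mu_G)/\sum_{t=1}^nX_{t-1}^2$.
   Formalization: The distribution G is additionally assumed not to be a point mass; for a point mass the claim fails (e.g. if ε_t = c ≥ 1 always and h = 0, then X_t − X_{t−1} = μ_G and the estimator is 0; if c = 0 it is 0/0). *)

(* Defs.v *)
From HB Require Import structures.
From mathcomp Require Import all_boot all_order all_algebra finmap.
From mathcomp Require Import all_classical all_reals all_analysis.

Set Implicit Arguments.
Unset Strict Implicit.
Unset Printing Implicit Defensive.
Import Order.TTheory GRing.Theory Num.Theory.
Import numFieldNormedType.Exports.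

Local Open Scope classical_set_scope.
Local Open Scope ring_scope.

Definition mutually_independent (d d' : measure_display) (R : realType)
    (T : measurableType d) (T' : measurableType d') (P : probability T R)
    (I : choiceType) (X : I -> {mfun T >-> T'}) : Prop :=
  forall (J : {fset I}) (A : I -> set T'), (forall i, measurable (A i)) ->
    P (\bigcap_(i in [set` J]) (X i @^-1` A i)) =
    (\big[mule/1]_(i <- J) P (X i @^-1` A i))%E.

Definition identically_distributed_as (d d' : measure_display) (R : realType)
    (T : measurableType d) (T' : measurableType d') (P : probability T R)
    (I : Type) (X : I -> {mfun T >-> T'}) (Q : set T' -> \bar R) : Prop :=
  forall i (A : set T'), measurable A -> distribution P (X i) A = Q A.

Definition sigma_family (d d' : measure_display)
    (T : measurableType d) (T' : measurableType d')
    (I : Type) (X : I -> {mfun T >-> T'}) : set (set T) :=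
  <<s \bigcup_i preimage_set_system [set: T] (X i) measurable >>.

Definition independent_families (d d1 d2 : measure_display) (R : realType)
    (T : measurableType d) (T1 : measurableType d1) (T2 : measurableType d2)
    (P : probability T R) (I1 I2 : Type)
    (X : I1 -> {mfun T >-> T1}) (Y : I2 -> {mfun T >-> T2}) : Prop :=
  forall A B : set T, sigma_family X A -> sigma_family Y B ->
    P (A `&` B) = (P A * P B)%E.

(* Indices are shifted by one, since the model has t and j start at 1:
   [Z (t, j)] is Z^{(t+1)}_{j+1} and [eps t] is eps_{t+1}. *)
Record inar1_inputs (d : measure_display) (R : realType)
    (T : measurableType d) (P : probability T R) (theta : R)
    (G : probability nat R) (Z : nat * nat -> {mfun T >-> bool})
    (eps : nat -> {mfun T >-> nat}) : Prop := Inar1Inputs {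
  thinning_indep : mutually_independent P Z;
  thinning_law : identically_distributed_as P Z (bernoulli_prob theta);
  innovation_indep : mutually_independent P eps;
  innovation_law : identically_distributed_as P eps G;
  thinning_innovation_indep : independent_families P Z eps }.

(* [Z (t, j) w : bool] is coerced to 0 or 1 in nat. *)
Fixpoint inar1 (d : measure_display) (T : measurableType d)
    (Z : nat * nat -> {mfun T >-> bool}) (eps : nat -> {mfun T >-> nat})
    (t : nat) (w : T) : nat :=
  if t is s.+1 then
    (\sum_(j < inar1 Z eps s w) Z (s, j : nat) w + eps s w)%N
  else 0%N.

Definition mean (R : realType) (G : probability nat R) : R :=
  fine 'E_G[(fun k : nat => k%:R : R)%R]%E.

(* The sum over t = 1, ..., n is reindexed by t - 1 < n. On the event that the
   denominator vanishes, the value is 0, since x / 0 = 0 in MathComp. *)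
Definition h_ols (R : realType) (mu : R) (n : nat) (x : nat -> nat) : R :=
  - (n%:R ^+ 2 *
     (\sum_(t < n) (x t)%:R * ((x t.+1)%:R - (x t)%:R - mu))
     / (\sum_(t < n) (x t)%:R ^+ 2)).

(* Main.v *)
Require Import Defs.
From HB Require Import structures.
From mathcomp Require Import all_boot all_order all_algebra finmap ring lra zify.
From mathcomp Require Import all_classical all_reals all_analysis measurable_realfun.
Import Order.TTheory GRing.Theory Num.Theory.
Import numFieldNormedType.Exports.
Set Implicit Arguments.
Unset Strict Implicit.
Unset Printing Implicit Defensive.
Local Open Scope classical_set_scope.
Local Open Scope ring_scope.

(** Write [xi_t = eps_t - mu], [S_n] for the sum of the first [n] innovations,
    [M_t = S_t - mu t], and [D_t] for the number of individuals that die in the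
    thinning step from time [t] to [t+1], with time starting at 0.  Then
    [X_t = mu t + M_t - C_t], where [C_t] is the number of deaths before [t], and
    the numerator of the estimator is, up to the factor [- n^2],

      [mu W_n + sum_t M_t xi_t - sum_t C_t xi_t - sum_t X_t D_t],

    with [W_n = sum_t t xi_t] (lemma [num_decomp]).  Apart from the first term,
    everything is of order [n] in probability:
    - twice [sum_t M_t xi_t] is [M_n^2 - sum_t xi_t^2], and both squares have
      expectation [n] times the variance;
    - the expected number of deaths up to [n] is at most
      [(h / n^2) * n^2 * mu = h mu] (lemma [expect_death_bound]), while [S_n] and
      [sum_t |xi_t|] are of order [n]; this controls the last two sums.
    The denominator is at most [n S_n^2], of order [n^3].  Hence the estimator
    is bounded only if [W_n] is of order [n], although its standard deviation is
    of order [n^(3/2)].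

    It remains to see that [P (|W_n| <= A n)] tends to 0 for each [A] (lemma
    [anticoncentration]).  For small [u], on this event the angles [k u W_n / n]
    with [k < L] have cosine at least [cos 1], so that [|sum_k e^(i k u W_n / n)|^2]
    is at least [(cos 1)^2 L^2]; its expectation is [L] plus [L (L - 1)]
    off-diagonal terms [E cos ((k - l) u W_n / n)].  The latter tend to 0:
    the squared modulus of the characteristic function of [W_n] at [lam] is the
    product over [m < n] of those of [xi] at [lam m], and because the
    innovations charge two distinct integers, the factors with [m >= n / 2] are
    bounded away from 1 (lemmas [char_law_le] and [char_sum_decay]).  So the limit
    superior of the probability is at most [1 / (L (cos 1)^2)] for every [L].
    Markov's inequality bounds the other terms, and the estimate is explicit in
    [n], so that the dependence of the probability on [n] is harmless. *)

(** * Real expectations *)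

Section real_integrable.
Context {d} {T : measurableType d} {R : realType} (P : probability T R).

(** Real-valued expectations are total, so linearity and monotonicity need an
    explicit integrability premise; this is the form in which it is carried. *)
Definition has_mean (f : T -> R) : Prop :=
  P.-integrable [set: T] (fun w => (f w)%:E).

Lemma eq_has_mean f g : f =1 g -> has_mean g -> has_mean f.
Proof. by move=> /funext ->. Qed.

Lemma has_meanD f g : has_mean f -> has_mean g ->
  has_mean (fun w => f w + g w).
Proof. by move=> fi gi; exact: (integrableD measurableT fi gi). Qed.

Lemma has_meanB f g : has_mean f -> has_mean g ->
  has_mean (fun w => f w - g w).
Proof. by move=> fi gi; exact: (integrableB measurableT fi gi). Qed.

Lemma has_meanZ c f : has_mean f -> has_mean (fun w => c * f w).
Proof. by move=> fi; exact: (integrableZl measurableT c fi). Qed.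

Lemma has_mean_cst c : has_mean (fun=> c).
Proof. exact: finite_measure_integrable_cst. Qed.

Lemma expect_cst c : \int[P]_w (fun=> c) w = c.
Proof. by rewrite /Rintegral integral_cst//= probability_setT mule1. Qed.

Lemma expectD f g : has_mean f -> has_mean g ->
  \int[P]_w (f w + g w) = \int[P]_w f w + \int[P]_w g w.
Proof. by move=> fi gi; rewrite RintegralD. Qed.

Lemma expectB f g : has_mean f -> has_mean g ->
  \int[P]_w (f w - g w) = \int[P]_w f w - \int[P]_w g w.
Proof. by move=> fi gi; rewrite RintegralB. Qed.

Lemma expectZ c f : has_mean f -> \int[P]_w (c * f w) = c * \int[P]_w f w.
Proof. by move=> fi; rewrite RintegralZl. Qed.

Lemma le_expect f g : has_mean f -> has_mean g -> (forall w, f w <= g w) ->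
  \int[P]_w f w <= \int[P]_w g w.
Proof. by move=> fi gi fg; apply: le_Rintegral. Qed.

Lemma expect_sum n (f : nat -> T -> R) : (forall i, has_mean (f i)) ->
  has_mean (fun w => \sum_(i < n) f i w) /\
  \int[P]_w (\sum_(i < n) f i w) = \sum_(i < n) \int[P]_w f i w.
Proof.
move=> fi; elim: n => [|n [sn En]].
  have f0 w : \sum_(i < 0) f i w = 0 by rewrite big_ord0.
  split; first by apply: (eq_has_mean f0); exact: has_mean_cst.
  by under eq_Rintegral do rewrite f0; rewrite (expect_cst 0) big_ord0.
have fS w : \sum_(i < n.+1) f i w = \sum_(i < n) f i w + f n w.
  by rewrite big_ord_recr.
split; first by apply: (eq_has_mean fS); exact: has_meanD.
by under eq_Rintegral do rewrite fS; rewrite expectD// En big_ord_recr.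
Qed.

Lemma has_mean_bounded (f : T -> R) c : measurable_fun [set: T] f ->
  (forall w, `|f w| <= c) -> has_mean f.
Proof.
move=> mf fc; apply: (le_integrable measurableT _ _ (has_mean_cst c)).
  exact/measurable_EFinP.
by move=> w _; rewrite /= lee_fin (le_trans (fc w))// ler_norm.
Qed.

Lemma expect_indic A : measurable A ->
  has_mean \1_A /\ \int[P]_w \1_A w = fine (P A).
Proof.
move=> mA; split; last by rewrite /Rintegral integral_indic// setIT.
apply: (@has_mean_bounded _ 1); first exact: measurable_indic.
by move=> w; rewrite indicE; case: (w \in A); rewrite ?normr1 ?normr0.
Qed.

End real_integrable.

(** Independence says that the joint law of [X] and [Y] is the product of the
    marginal laws (both agree on rectangles), and for a product measure this is
    Fubini's theorem, preceded by Tonelli's theorem for integrability. *)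
Lemma expect_mul_indep {d} {T : measurableType d} {R : realType}
    (P : probability T R) (X Y : T -> R) :
  has_mean P X -> has_mean P Y ->
  (forall A B : set R, measurable A -> measurable B ->
     P (X @^-1` A `&` Y @^-1` B) = (P (X @^-1` A) * P (Y @^-1` B))%E) ->
  has_mean P (fun w => X w * Y w) /\
  \int[P]_w (X w * Y w) = (\int[P]_w X w) * (\int[P]_w Y w).
Proof.
move=> iX iY indep.
have mX : measurable_fun [set: T] X.
  exact/measurable_EFinP/(measurable_int P).
have mY : measurable_fun [set: T] Y.
  exact/measurable_EFinP/(measurable_int P).
pose X' : {mfun T >-> R} :=
  HB.pack X (isMeasurableFun.Build _ _ _ _ _ mX).
pose Y' : {mfun T >-> R} :=
  HB.pack Y (isMeasurableFun.Build _ _ _ _ _ mY).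
pose Z (w : T) : (R * R)%type := (X w, Y w).
have mZ : measurable_fun [set: T] Z by exact: measurable_fun_pair.
pose Z' : {mfun T >-> (R * R)%type} :=
  HB.pack Z (isMeasurableFun.Build _ _ _ _ _ mZ).
pose m1 := distribution P X'; pose m2 := distribution P Y'.
have prodE : forall A, measurable A -> (m1 \x m2)%E A = distribution P Z' A.
  apply: product_measure_unique => A B mA mB.
  rewrite /m1 /m2 /distribution /pushforward/= -indep//.
pose f (z : R * R) : \bar R := (z.1 * z.2)%:E.
have mf : measurable_fun setT f.
  by apply/measurable_EFinP; apply: measurable_funM => //; exact: measurable_fst.
have absZ : (\int[P]_w `|(X w * Y w)%:E| = \int[m1 \x m2]_z `|f z|)%E.
  transitivity (\int[distribution P Z']_z `|f z|)%E.
    rewrite ge0_integral_pushforward//; exact: measurableT_comp.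
  by apply: eq_measure_integral => A mA _; exact/esym/prodE.
have id1 : measurable_fun [set: R]
    (fun x : R => x%:E) by exact/measurable_EFinP.
have im1 : m1.-integrable setT (fun x : R => x%:E).
  by apply: integrable_pushforward => //; exact: iX.
have im2 : m2.-integrable setT (fun x : R => x%:E).
  by apply: integrable_pushforward => //; exact: iY.
have fin2 : (\int[m2]_y `|y%:E| < +oo)%E by case/integrableP: im2.
have fin1 : (\int[m1]_y `|y%:E| < +oo)%E by case/integrableP: im1.
have iff : (m1 \x m2)%E.-integrable setT f.
  apply/integrable12ltyP => //.
  under eq_integral => x _.
    under eq_integral => y _ do rewrite /f/= normrM EFinM.
    rewrite ge0_integralZl//; last exact: measurableT_comp.
    over.
  rewrite ge0_integralZr//; last by rewrite integral_ge0.
    by rewrite lte_mul_pinfty ?integral_ge0// ge0_fin_numE ?integral_ge0.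
  by apply/measurable_EFinP; exact: normr_measurable.
have iXY : has_mean P (fun w => X w * Y w).
  apply/integrableP; split.
    by apply/measurable_EFinP; apply: measurable_funM.
  by rewrite absZ; case/integrableP: iff.
split => //.
rewrite /Rintegral.
have -> : (\int[P]_w (X w * Y w)%:E = \int[m1 \x m2]_z f z)%E.
  transitivity (\int[distribution P Z']_z f z)%E.
    by rewrite integral_pushforward.
  by apply: eq_measure_integral => A mA _; exact/esym/prodE.
rewrite -integral12_prod_meas1//= /fubini_F/=.
have -> : (\int[P]_w (X w)%:E = \int[m1]_x x%:E)%E.
  by rewrite integral_pushforward//; exact: iX.
have -> : (\int[P]_w (Y w)%:E = \int[m2]_x x%:E)%E.
  by rewrite integral_pushforward//; exact: iY.
under eq_integral => x _.
  under eq_integral => y _ do rewrite /f/= EFinM.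
  rewrite integralZl//.
  over.
rewrite -fineM; last 2 first.
  exact: integrable_fin_num.
  exact: integrable_fin_num.
by rewrite /= -(fineK (integrable_fin_num _ im2))// integralZr.
Qed.

(** * Sets determined by a countable-valued map *)

Definition fiber {T C : Type} (V : T -> C) (v : C) : set T := [set w | V w = v].

(** The event [A] depends on the outcome only through [V]. *)
Definition determined_by {T C : Type} (V : T -> C) (A : set T) : Prop :=
  forall w w', V w = V w' -> A w -> A w'.

(** Cutting [A] along the values of [V], enumerated by [nat] so that countable
    additivity applies directly. *)
Definition slice {T : Type} {C : countType} (V : T -> C) (A : set T) (i : nat) :
  set T := A `&` [set w | choice.pickle (V w) = i].

Lemma bigcup_slice {T : Type} {C : countType} (V : T -> C) (A : set T) :
  \bigcup_i slice V A i = A.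
Proof.
apply/seteqP; split => [w [i _ []]//|w Aw].
by exists (choice.pickle (V w)).
Qed.

Lemma trivIset_slice {T : Type} {C : countType} (V : T -> C) (A : set T) :
  trivIset setT (slice V A).
Proof. by move=> i j _ _ [w [[_ /= <-] [_ /= <-]]]. Qed.

Lemma slice_determined {T : Type} {C : countType} (V : T -> C) (A : set T) i :
  determined_by V A ->
  slice V A i = set0 \/ exists v, slice V A i = fiber V v.
Proof.
move=> detA; have [[w [Aw Vw]]|nA] := pselect (slice V A i !=set0).
  right; exists (V w); apply/seteqP; split => w'.
    by move=> [_ /= Vw']; apply: (pcan_inj choice.pickleK); rewrite Vw'.
  by move=> Vw'; split; [exact: detA Aw|rewrite /= Vw'].
by left; apply/seteqP; split => w //= Aw; apply: nA; exists w.
Qed.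

(** Discreteness replaces all measurability bookkeeping: such a set is a countable
    union of fibers.  The measurable structure on [T] is arbitrary, which
    allows using this also for the sigma-algebra generated by a family. *)
Lemma measurable_determined {d} {T : measurableType d} {C : countType}
    (V : T -> C) (A : set T) :
  (forall v, measurable (fiber V v)) -> determined_by V A -> measurable A.
Proof.
move=> mV detA; rewrite -(bigcup_slice V A).
apply: bigcup_measurable => i _.
by have [->|[v ->]] := slice_determined i detA; [exact: measurable0|exact: mV].
Qed.

Lemma measurable_fun_determined {d d'} {T : measurableType d}
    {T' : measurableType d'} {C : countType} (V : T -> C) (f : T -> T') :
  (forall v, measurable (fiber V v)) -> (forall w w', V w = V w' -> f w = f w') ->
  measurable_fun setT f.
Proof.
move=> mV detf _ B _; rewrite setTI; apply: (measurable_determined mV).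
by move=> w w' /detf; rewrite /preimage/= => ->.
Qed.

Lemma fiber_pair {T C C' : Type} (V : T -> C) (U : T -> C') (c : C * C') :
  fiber (fun w => (V w, U w)) c = fiber V c.1 `&` fiber U c.2.
Proof.
by case: c => c c'; apply/seteqP; split => w; [case=> <- <-|case=> /= <- <-].
Qed.

Lemma fiber_mkseq {T : Type} {C : eqType} (x0 : C) (f : nat -> T -> C) n s :
  fiber (fun w => mkseq (f^~ w) n) s =
  if size s == n then \bigcap_(i < n) fiber (f i) (nth x0 s i) else set0.
Proof.
case: eqP => [sn|sn]; apply/seteqP; split => // w.
- by move=> /= <- i /= ni; rewrite /fiber/= nth_mkseq.
- move=> /= E; apply: (@eq_from_nth _ x0); rewrite size_mkseq// => i ni.
  by rewrite nth_mkseq// (E i ni).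
- by move=> /= E; apply: sn; rewrite -E size_mkseq.
Qed.

Lemma measurable_fiber_mkseq {d} {T : measurableType d} {C : eqType} (x0 : C)
    (f : nat -> T -> C) n :
  (forall i v, measurable (fiber (f i) v)) ->
  forall s, measurable (fiber (fun w => mkseq (f^~ w) n) s).
Proof.
move=> mf s; rewrite (fiber_mkseq x0); case: eqP => // _.
by apply: bigcap_measurableType => i _.
Qed.

(** Independence of the fibers of [V] from [B] passes to countable disjoint unions
    of fibers. *)
Lemma prob_determined_indep {d} {T : measurableType d} {R : realType}
    (P : probability T R) {C : countType} (V : T -> C) (A B : set T) :
  (forall v, measurable (fiber V v)) -> measurable B ->
  (forall v, P (fiber V v `&` B) = (P (fiber V v) * P B)%E) ->
  determined_by V A -> P (A `&` B) = (P A * P B)%E.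
Proof.
move=> mV mB indep detA.
have mS i : measurable (slice V A i).
  by have [->|[v ->]] := slice_determined i detA; [exact: measurable0|exact: mV].
rewrite -{1}(bigcup_slice V A) setI_bigcupl measure_bigcup//; first last.
- apply/trivIsetP => i j _ _ ij; rewrite setIACA setIid.
  by have /trivIsetP/(_ i j Logic.I Logic.I ij) -> := @trivIset_slice _ _ V A; rewrite set0I.
- by move=> i _; exact: measurableI.
rewrite -{2}(bigcup_slice V A) measure_bigcup//; last exact: trivIset_slice.
have PB : P B = (fine (P B))%:E by rewrite fineK// fin_num_measure.
rewrite muleC PB -nneseriesZl//; apply: eq_eseriesr => i _; rewrite -PB muleC.
have [->|[v ->]] := slice_determined i detA; last exact: indep.
by rewrite set0I measure0 mul0e.
Qed.

(** * The past and the next innovation *)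

Definition past {T C : Type} (X : nat -> T -> C) (n : nat) (w : T) : seq C :=
  mkseq (X^~ w) n.

Lemma past_eq {T C : Type} (X : nat -> T -> C) n w w' :
  past X n w = past X n w' -> forall i, (i < n)%N -> X i w = X i w'.
Proof.
move=> E i ni; have := congr1 (fun s => nth (X i w) s i) E.
by rewrite !nth_mkseq.
Qed.

Lemma measurable_fiber_nat {d} {T : measurableType d} (e : {mfun T >-> nat}) v :
  measurable (fiber e v).
Proof. exact: (measurable_funPTI e (Y := [set v])). Qed.

(** On a cylinder [eps_0 = v_0, ..., eps_(n-1) = v_(n-1)] this compares the
    product formula over [n+1] indices with the one over [n] indices. *)
Lemma prob_past_next {d} {T : measurableType d} {R : realType}
    (P : probability T R) (eps : nat -> {mfun T >-> nat}) n (A : set T) (B : set nat) :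
  mutually_independent P eps -> determined_by (past eps n) A ->
  P (A `&` eps n @^-1` B) = (P A * P (eps n @^-1` B))%E.
Proof.
move=> indep; apply: prob_determined_indep.
- by move=> v; apply: (measurable_fiber_mkseq 0%N) => i u; exact: measurable_fiber_nat.
- exact: measurable_funPTI.
move=> v; rewrite (fiber_mkseq 0%N); case: eqP => _; last first.
  by rewrite set0I measure0 mul0e.
(* The indices before [n], constrained by [v]; the index [n] is constrained by [B]. *)
pose J : {fset nat} := [fset i in iota 0 n]%fset.
have JE i : (i \in J) = (i < n)%N by rewrite !inE mem_iota add0n.
have nJ : n \notin J by rewrite JE ltnn.
pose D i : set nat := if (i < n)%N then [set nth 0%N v i] else B.
have DE i : i \in J -> D i = [set nth 0%N v i] by rewrite JE /D => ->.
have Dn : D n = B by rewrite /D ltnn.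
have mD i : measurable (D i) by [].
have past_cyl : \bigcap_(i < n) fiber (eps i) (nth 0%N v i) =
    \bigcap_(i in [set` J]) (eps i @^-1` D i).
  apply/seteqP; split => w /= E i.
    by move=> /= iJ; have := iJ; rewrite JE => /E; rewrite /preimage/= DE.
  move=> /= ni; have iJ : i \in J by rewrite JE.
  by have := E i iJ; rewrite /preimage/= DE.
have := indep (n |` J)%fset _ mD.
rewrite big_fsetU1//= -(indep J _ mD) -past_cyl Dn muleC => <-.
congr (P _); rewrite past_cyl; apply/seteqP; split => w /=.
  move=> [E Bw] i /=; rewrite in_fset1U => /orP[/eqP ->|/E//].
  by rewrite /preimage/= Dn.
move=> E; split; last by have := E n; rewrite /preimage/= Dn; apply; exact: fset1U1.
by move=> i /= iJ; apply: E; rewrite /= in_fset1U iJ orbT.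
Qed.

Lemma expect_past_next {d} {T : measurableType d} {R : realType}
    (P : probability T R) (eps : nat -> {mfun T >-> nat}) n (X : T -> R) (f : nat -> R) :
  mutually_independent P eps ->
  (forall w w', past eps n w = past eps n w' -> X w = X w') ->
  has_mean P X ->
  has_mean P (fun w => f (eps n w)) ->
  has_mean P (fun w => X w * f (eps n w)) /\
  \int[P]_w (X w * f (eps n w)) = (\int[P]_w X w) * (\int[P]_w f (eps n w)).
Proof.
move=> indep detX iX ie.
apply: (expect_mul_indep iX ie) => A B mA mB.
apply: (@prob_past_next _ _ _ _ _ _ _ (f @^-1` B)) => // w w' /detX.
by rewrite /preimage/= => ->.
Qed.

(** Change of variables: expectations of functions of one innovation are
    integrals against [G], whatever the underlying probability. *)
Lemma law_integrable {d} {T : measurableType d} {R : realType}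
    (P : probability T R) (G : probability nat R) (eps : nat -> {mfun T >-> nat})
    n (f : nat -> R) :
  identically_distributed_as P eps G -> has_mean G f ->
  has_mean P (fun w => f (eps n w)).
Proof.
move=> law /integrableP[_ iG]; apply/integrableP; split.
  by apply/measurable_EFinP; exact: measurableT_comp.
rewrite [ltLHS](_ : _ = \int[distribution P (eps n)]_k `|(f k)%:E|)%E.
  by rewrite (eq_measure_integral G) // => A mA _; exact: law.
by rewrite ge0_integral_pushforward.
Qed.

Lemma law_expect {d} {T : measurableType d} {R : realType}
    (P : probability T R) (G : probability nat R) (eps : nat -> {mfun T >-> nat})
    n (f : nat -> R) :
  identically_distributed_as P eps G -> has_mean G f ->
  \int[P]_w f (eps n w) = \int[G]_k f k.
Proof.
move=> law iG; rewrite /Rintegral; congr fine.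
transitivity (\int[distribution P (eps n)]_k (f k)%:E)%E.
  rewrite integral_pushforward//; exact: (law_integrable _ law iG).
by apply: eq_measure_integral => A mA _; exact: law.
Qed.

(** * Moments of the innovation sums *)

Lemma markov_ge0 {d} {T : measurableType d} {R : realType}
    (P : probability T R) (X : T -> R) (c : R) :
  measurable_fun [set: T] X -> (forall w, 0 <= X w) -> 0 < c ->
  (P [set w | (c <= X w)%R] <= c^-1%:E * \int[P]_w (X w)%:E)%E.
Proof.
move=> mX X0 c0.
have mA : measurable [set w | c <= X w].
  by rewrite -[X in measurable X]setTI; exact: measurable_fun_ler.
rewrite lee_pdivlMl// -(setIT [set w | c <= X w]) -integral_indic//.
rewrite -ge0_integralZl//; last 2 first.
- by apply/measurable_EFinP; exact: measurable_indic.
- by rewrite lee_fin ltW.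
apply: ge0_le_integral => //.
- by move=> w _; rewrite -EFinM lee_fin mulr_ge0// ltW.
- by apply/measurable_EFinP; apply: measurable_funM => //; exact: measurable_indic.
- exact/measurable_EFinP.
- move=> w _; rewrite -EFinM lee_fin indicE; case: (boolP (w \in _)).
    by rewrite inE mulr1.
  by rewrite mulr0.
Qed.

(** The mean of [G] as a real integral; it agrees with [mean G] because the
    expectation operator is an integral. *)
Definition mean_of {R : realType} (G : probability nat R) : R :=
  \int[G]_k k%:R.

Definition variance_of {R : realType} (G : probability nat R) : R :=
  \int[G]_k (k%:R - mean_of G) ^+ 2.

(** On natural numbers [k ^ p <= 1 + k ^ 3] as soon as [p <= 3]. *)
Lemma integrable_pow_le3 {R : realType} (G : probability nat R) (p : nat) :
  ('E_G[(fun k : nat => k%:R ^+ 3 : R)%R] < +oo)%E -> (p <= 3)%N ->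
  has_mean G (fun k => k%:R ^+ p).
Proof.
rewrite unlock => m3 p3; apply: (@le_integrable _ _ _ _ _ _ _
   (fun k : nat => (1 + k%:R ^+ 3 : R)%:E)) => //.
  move=> k _; rewrite /= lee_fin !ger0_norm ?addr_ge0 ?exprn_ge0 ?ler0n//.
  case: k => [|k].
    by rewrite mulr0n !expr0n /= addr0 lern1 leq_b1.
  apply: (@le_trans _ _ (k.+1%:R ^+ 3)); last by rewrite lerDr.
  by rewrite ler_weXn2l// ler1n.
apply: has_meanD; first exact: has_mean_cst.
apply/integrableP; split => //.
under eq_integral => k _ do rewrite gee0_abs ?lee_fin ?exprn_ge0//.
by [].
Qed.

Section moments.
Context {d} {T : measurableType d} {R : realType} (P : probability T R)
  (G : probability nat R) (eps : nat -> {mfun T >-> nat}).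
Context (indep : mutually_independent P eps)
  (law : identically_distributed_as P eps G)
  (G1 : has_mean G (fun k => k%:R))
  (G2 : has_mean G (fun k => k%:R ^+ 2)).

Local Notation mu := (mean_of G).
Local Notation xi i w := ((eps i w)%:R - mu).

Definition innov_sum (n : nat) (w : T) : nat := (\sum_(i < n) eps i w)%N.
Definition centered_sum (n : nat) (w : T) : R := \sum_(i < n) xi i w.

Lemma integrable_center : has_mean G (fun k => k%:R - mu).
Proof. by apply: has_meanB => //; exact: has_mean_cst. Qed.

Lemma integrable_center2 :
  has_mean G (fun k => (k%:R - mu) ^+ 2).
Proof.
have sqE k : (k%:R - mu) ^+ 2 = k%:R ^+ 2 - 2 * mu * k%:R + mu ^+ 2 by ring.
apply: (eq_has_mean sqE); apply: has_meanD; last exact: has_mean_cst.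
by apply: has_meanB => //; exact: has_meanZ.
Qed.

Lemma expect_center : \int[G]_k (k%:R - mu) = 0.
Proof.
rewrite expectB//; last exact: has_mean_cst.
by rewrite expect_cst subrr.
Qed.

Lemma centered_sum_past n w w' :
  past eps n w = past eps n w' -> centered_sum n w = centered_sum n w'.
Proof. by move=> E; apply: eq_bigr => i _; rewrite (past_eq E). Qed.

Lemma innov_sum_past n w w' :
  past eps n w = past eps n w' -> innov_sum n w = innov_sum n w'.
Proof. by move=> E; apply: eq_bigr => i _; rewrite (past_eq E). Qed.

(** In [M_(n+1)^2 = M_n^2 + 2 M_n xi_n + xi_n^2] the middle term has expectation
    0, because [M_n] depends only on the innovations before the [n]-th. *)
Lemma centered_sum_moments n :
  [/\ has_mean P (centered_sum n),
      has_mean P (fun w => centered_sum n w ^+ 2),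
      \int[P]_w centered_sum n w = 0 &
      \int[P]_w (centered_sum n w ^+ 2) = n%:R * variance_of G].
Proof.
have ix i : has_mean P (fun w => xi i w).
  exact: (law_integrable i law integrable_center).
have ix2 i : has_mean P (fun w => (xi i w) ^+ 2).
  exact: (law_integrable i law integrable_center2).
have Ex i : \int[P]_w xi i w = 0.
  by rewrite (law_expect i law integrable_center) expect_center.
have Ex2 i : \int[P]_w (xi i w) ^+ 2 = variance_of G.
  exact: (law_expect i law integrable_center2).
elim: n => [|n [iM iM2 EM EM2]].
  have c0 : centered_sum 0 = cst 0.
    by apply/funext => w; rewrite /centered_sum big_ord0.
  rewrite c0 mul0r; split => //.
  - exact: has_mean_cst.
  - exact: (has_mean_cst P (0 ^+ 2)).
  - by rewrite expect_cst.
  - by rewrite (expect_cst P (0 ^+ 2)) expr0n.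
have MS w : centered_sum n.+1 w = centered_sum n w + xi n w.
  by rewrite /centered_sum big_ord_recr.
have M2S w : centered_sum n.+1 w ^+ 2 =
    centered_sum n w ^+ 2 + 2 * (centered_sum n w * xi n w) + xi n w ^+ 2.
  by rewrite MS; ring.
have [iMx EMx] :=
  expect_past_next (f := fun k => k%:R - mu) indep (@centered_sum_past n) iM (ix n).
have i2Mx : has_mean P (fun w => 2 * (centered_sum n w * xi n w)).
  exact: has_meanZ.
split.
- by apply: (eq_has_mean MS); exact: has_meanD.
- by apply: (eq_has_mean M2S); apply: has_meanD => //; exact: has_meanD.
- under eq_Rintegral do rewrite MS.
  by rewrite expectD// EM Ex addr0.
- under eq_Rintegral do rewrite M2S.
  rewrite expectD//; last exact: has_meanD.
  rewrite expectD// expectZ// EMx EM mul0r mulr0 addr0 EM2 Ex2.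
  by rewrite -natr1 mulrDl mul1r.
Qed.

Lemma expect_innov_sum n :
  has_mean P (fun w => (innov_sum n w)%:R) /\
  \int[P]_w (innov_sum n w)%:R = n%:R * mu.
Proof.
have [iM _ EM _] := centered_sum_moments n.
have SE w : (innov_sum n w)%:R = centered_sum n w + n%:R * mu.
  rewrite /centered_sum /innov_sum sumrB natr_sum sumr_const card_ord.
  by rewrite -[mu *+ n]mulr_natl subrK.
have ic : has_mean P (fun=> n%:R * mu).
  exact: has_mean_cst.
split; first by apply: (eq_has_mean SE); exact: has_meanD.
under eq_Rintegral do rewrite SE.
by rewrite expectD// EM add0r expect_cst.
Qed.

(** Summation by parts: this expresses the martingale transform through squares,
    whose expectations are known. *)
Lemma martingale_sum n w :
  2 * (\sum_(t < n) centered_sum t w * xi t w) =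
  centered_sum n w ^+ 2 - \sum_(t < n) xi t w ^+ 2.
Proof.
elim: n => [|n IH]; first by rewrite /centered_sum !big_ord0 expr0n mulr0 subr0.
rewrite !big_ord_recr/= mulrDr IH {3}/centered_sum big_ord_recr/=.
by rewrite -/(centered_sum n w); ring.
Qed.

(** A nonnegative variable that dominates the martingale transform above and to
    which Markov's inequality applies. *)
Definition quadratic_sum n w : R :=
  centered_sum n w ^+ 2 + \sum_(t < n) xi t w ^+ 2.

Lemma expect_quadratic_sum n :
  has_mean P (quadratic_sum n) /\
  \int[P]_w quadratic_sum n w = 2 * (n%:R * variance_of G).
Proof.
have ix2 i : has_mean P (fun w => (xi i w) ^+ 2).
  exact: (law_integrable i law integrable_center2).
have Ex2 i : \int[P]_w (xi i w) ^+ 2 = variance_of G.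
  exact: (law_expect i law integrable_center2).
have [_ iM2 _ EM2] := centered_sum_moments n.
have [iQ EQ] := expect_sum n ix2.
split; first exact: has_meanD.
rewrite expectD// EM2 EQ; under eq_bigr do rewrite Ex2.
by rewrite sumr_const card_ord -mulr_natl; ring.
Qed.

End moments.

(** * Counting deaths *)

(** A sum with a random number of terms is a series of indicators, all of which
    vanish from the index [N w] on. *)
Lemma random_sumE {T : Type} {R : realType} (N : T -> nat) (B : nat -> set T) w :
  ((\sum_(j < N w) \1_(B j) w)%:E =
   \sum_(j <oo) (\1_([set w | (j < N w)%N] `&` B j) w)%:E :> \bar R)%E.
Proof.
rewrite (nneseries_split 0 (N w)); last by move=> k _; rewrite lee_fin.
rewrite add0n [X in (_ + X)%E]eseries0 ?adde0; last first.
  move=> k Nk _; rewrite indicE memNset// => -[/=]; rewrite ltnNge Nk//.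
rewrite -sumEFin big_mkord; apply: eq_bigr => j _.
rewrite !indicE in_setI (_ : (w \in [set w | (j < N w)%N]) = true)//.
exact: (mem_set (ltn_ord j)).
Qed.

Lemma measurable_random_sum {d} {T : measurableType d} {R : realType}
    (N : T -> nat) (B : nat -> set T) :
  (forall j, measurable [set w | (j < N w)%N]) -> (forall j, measurable (B j)) ->
  measurable_fun setT (fun w => (\sum_(j < N w) \1_(B j) w)%:E : \bar R).
Proof.
move=> mN mB; under eq_fun do rewrite random_sumE.
apply: ge0_emeasurable_sum => [j w _ _|j _]; first by rewrite lee_fin.
by apply/measurable_EFinP; apply: measurable_indic; exact: measurableI.
Qed.

Lemma integral_random_sum {d} {T : measurableType d} {R : realType}
    (P : probability T R) (N : T -> nat) (B : nat -> set T) :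
  (forall j, measurable [set w | (j < N w)%N]) -> (forall j, measurable (B j)) ->
  (\int[P]_w (\sum_(j < N w) \1_(B j) w)%:E =
   \sum_(j <oo) P ([set w | (j < N w)%N] `&` B j))%E.
Proof.
move=> mN mB.
under eq_integral do rewrite random_sumE.
rewrite integral_nneseries//; last first.
  by move=> j; apply/measurable_EFinP; apply: measurable_indic; exact: measurableI.
by apply: eq_eseriesr => j _; rewrite integral_indic ?setIT//; exact: measurableI.
Qed.

(** Wald's identity for indicators.  The event [B j] only has to be independent of
    [j < N], and the case [B j = setT] recovers the expectation of [N] as
    the sum of its tails. *)
Lemma wald_indicator {d} {T : measurableType d} {R : realType}
    (P : probability T R) (N : T -> nat) (B : nat -> set T) (q : R) :
  (forall j, measurable [set w | (j < N w)%N]) -> (forall j, measurable (B j)) ->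
  (forall j, P ([set w | (j < N w)%N] `&` B j) =
             (q%:E * P [set w | (j < N w)%N])%E) ->
  (\int[P]_w (\sum_(j < N w) \1_(B j) w)%:E = q%:E * \int[P]_w (N w)%:R%:E)%E.
Proof.
move=> mN mB NB; rewrite integral_random_sum//.
have NE w : ((N w)%:R%:E = (\sum_(j < N w) \1_([set: T]) w)%:E :> \bar R).
  by congr EFin; under eq_bigr do rewrite indicT; rewrite sumr_const card_ord.
under [in RHS]eq_integral do rewrite NE.
rewrite (integral_random_sum P (B := fun=> setT))//.
rewrite -nneseriesZl//.
by apply: eq_eseriesr => j _; rewrite setIT NB.
Qed.

Section deaths.
Context {d} {T : measurableType d} {R : realType} (P : probability T R)
  (theta : R) (G : probability nat R) (Z : nat * nat -> {mfun T >-> bool})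
  (eps : nat -> {mfun T >-> nat}).
Context (model : inar1_inputs P theta G Z eps) (theta01 : 0 <= theta <= 1)
  (G1 : has_mean G (fun k => k%:R))
  (G2 : has_mean G (fun k => k%:R ^+ 2)).

(** The fibers of the past are measurable for the sigma-algebra generated by the
    innovations, so every event determined by the past belongs to it. *)
Lemma innov_sum_sigma t j : sigma_family eps [set w | (j < innov_sum eps t w)%N].
Proof.
rewrite /sigma_family; set E := (X in <<s X >>).
apply: (@measurable_determined _ (g_sigma_algebraType E) _ (past eps t)).
  apply: (measurable_fiber_mkseq 0%N) => i v.
  apply: sub_sigma_algebra; exists i => //.
  by exists [set v] => //; rewrite setTI.
by move=> w w' /innov_sum_past /= ->.
Qed.

Lemma death_preimage t j :
  [set w | ~~ Z (t, j) w] = Z (t, j) @^-1` [set false].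
Proof. by apply/seteqP; split => w /=; case: (Z (t, j) w). Qed.

Lemma thinning_sigma t j : sigma_family Z [set w | ~~ Z (t, j) w].
Proof.
apply: sub_sigma_algebra; exists (t, j) => //.
by exists [set false] => //; rewrite setTI death_preimage.
Qed.

Lemma prob_death t j : P [set w | ~~ Z (t, j) w] = (1 - theta)%:E.
Proof.
rewrite death_preimage.
rewrite -[LHS]/(distribution P (Z (t, j)) [set false]).
rewrite (thinning_law model (t, j) (A := [set false]) Logic.I) bernoulli_probE//.
by rewrite !diracE memNset// mem_set// mule0 add0e mule1.
Qed.

(** The deaths that would occur if all individuals ever born were still alive.
    It dominates the true number of deaths, and the population size in
    it depends only on the innovations, which are independent of the thinning. *)
Definition death_bound (n : nat) (w : T) : nat :=
  (\sum_(t < n) \sum_(j < innov_sum eps t w) ~~ Z (t : nat, j : nat) w)%N.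

Lemma measurable_innov_sum t j : measurable [set w | (j < innov_sum eps t w)%N].
Proof.
have mV := measurable_fiber_mkseq 0%N t (fun i v => measurable_fiber_nat (eps i) v).
by apply: (measurable_determined mV) => w w' /innov_sum_past /= ->.
Qed.

Lemma measurable_death t j : measurable [set w | ~~ Z (t, j) w].
Proof. by rewrite death_preimage; exact: measurable_funPTI. Qed.

Lemma death_boundE n w : (death_bound n w)%:R = \sum_(t < n)
  (\sum_(j < innov_sum eps t w) \1_[set w | ~~ Z (t : nat, j : nat) w] w : R).
Proof.
rewrite natr_sum; apply: eq_bigr => t _; rewrite natr_sum; apply: eq_bigr => j _.
by rewrite indicE mem_setE.
Qed.

Lemma measurable_death_bound n :
  measurable_fun [set: T] (fun w => (death_bound n w)%:R : R).
Proof.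
under eq_fun do rewrite death_boundE.
apply: measurable_sum => t; apply/measurable_EFinP.
exact: (measurable_random_sum (measurable_innov_sum t) (measurable_death t)).
Qed.

Lemma expect_death_bound n :
  (\int[P]_w (death_bound n w)%:R%:E <=
    ((1 - theta) * (n%:R ^+ 2 * mean_of G))%:E)%E.
Proof.
have Et t : (\int[P]_w (\sum_(j < innov_sum eps t w)
      \1_[set w | ~~ Z (t : nat, j : nat) w] w)%:E =
    ((1 - theta) * (t%:R * mean_of G))%:E)%E.
  rewrite (wald_indicator (N := innov_sum eps t)
    (B := fun j => [set w | ~~ Z (t, j) w]) (q := 1 - theta)).
  - have [iS ES] :=
      expect_innov_sum (innovation_indep model) (innovation_law model) G1 G2 t.
    rewrite EFinM -ES /Rintegral fineK//; exact: integrable_fin_num.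
  - exact: measurable_innov_sum.
  - exact: measurable_death.
  - move=> j; rewrite setIC.
    rewrite (thinning_innovation_indep model (thinning_sigma t j) (innov_sum_sigma t j)).
    by rewrite prob_death.
under eq_integral do rewrite death_boundE -sumEFin.
rewrite ge0_integral_sum//; last 2 first.
- by move=> t; exact: (measurable_random_sum (measurable_innov_sum t) (measurable_death t)).
- by move=> t w _; rewrite lee_fin sumr_ge0.
under eq_bigr do rewrite Et.
have mu0 : 0 <= mean_of G by apply: Rintegral_ge0.
rewrite sumEFin lee_fin -mulr_sumr; apply: ler_wpM2l.
  by case/andP: theta01 => _; rewrite subr_ge0.
rewrite -mulr_suml; apply: ler_wpM2r => //.
apply: (@le_trans _ _ (\sum_(t < n) n%:R)).
  by apply: ler_sum => t _; rewrite ler_nat ltnW.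
by rewrite sumr_const card_ord -[n%:R *+ n]mulr_natl expr2.
Qed.

End deaths.

(** * Characteristic functions of the weighted sum *)

Section weighted_sum.
Context {d} {T : measurableType d} {R : realType} (P : probability T R)
  (G : probability nat R) (eps : nat -> {mfun T >-> nat}).
Context (indep : mutually_independent P eps)
  (law : identically_distributed_as P eps G).

Local Notation mu := (mean_of G).
Local Notation xi i w := ((eps i w)%:R - mu).

Definition weighted_sum (n : nat) (w : T) : R := \sum_(t < n) t%:R * xi t w.

Lemma past_measurable n (f : T -> R) :
  (forall w w', past eps n w = past eps n w' -> f w = f w') ->
  measurable_fun [set: T] f.
Proof.
apply: measurable_fun_determined.
exact: (measurable_fiber_mkseq 0%N n (fun i v => measurable_fiber_nat (eps i) v)).
Qed.

Lemma weighted_sum_past n w w' :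
  past eps n w = past eps n w' -> weighted_sum n w = weighted_sum n w'.
Proof. by move=> E; apply: eq_bigr => i _; rewrite (past_eq E). Qed.

Lemma measurable_weighted_sum n : measurable_fun [set: T] (weighted_sum n).
Proof. exact: (past_measurable (@weighted_sum_past n)). Qed.

Lemma sin_max (x : R) : `|sin x| <= 1.
Proof. by rewrite ler_norml sin_geN1 sin_le1. Qed.

Lemma has_mean_past n (g : R -> R) (X : T -> R) :
  (forall x, `|g x| <= 1) ->
  (forall w w', past eps n w = past eps n w' -> X w = X w') ->
  has_mean P (fun w => g (X w)).
Proof.
move=> g1 detX; apply: (has_mean_bounded _ (c := 1)) => //.
by apply: (past_measurable (n := n)) => w w' /detX ->.
Qed.

Lemma has_mean_law (g : R -> R) (f : nat -> R) : (forall x, `|g x| <= 1) ->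
  has_mean G (fun k => g (f k)).
Proof. by move=> g1; apply: (has_mean_bounded _ (c := 1)). Qed.

(** Real and imaginary parts of the characteristic functions of a centered
    innovation and of the weighted sum. *)
Definition cos_law (tau : R) : R := \int[G]_k cos (tau * (k%:R - mu)).
Definition sin_law (tau : R) : R := \int[G]_k sin (tau * (k%:R - mu)).
Definition cos_sum lam n : R := \int[P]_w cos (lam * weighted_sum n w).
Definition sin_sum lam n : R := \int[P]_w sin (lam * weighted_sum n w).

(** The factorization behind the multiplicativity of characteristic functions;
    [g] and [g'] are each the sine or the cosine. *)
Lemma expect_trig_next n (X : T -> R) (g g' : R -> R) (tau : R) :
  (forall x, `|g x| <= 1) -> (forall x, `|g' x| <= 1) ->
  (forall w w', past eps n w = past eps n w' -> X w = X w') ->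
  has_mean P (fun w => g (X w) * g' (tau * xi n w)) /\
  \int[P]_w (g (X w) * g' (tau * xi n w)) =
    (\int[P]_w g (X w)) * \int[G]_k g' (tau * (k%:R - mu)).
Proof.
move=> g1 g'1 detX.
pose f k := g' (tau * (k%:R - mu)).
have mf : has_mean G f by exact: has_mean_law.
rewrite -(law_expect n law mf).
apply: (expect_past_next (X := fun w => g (X w)) (f := f)) => //.
- by move=> w w' /detX ->.
- exact: (has_mean_past g1 detX).
- exact: (law_integrable n law mf).
Qed.

(** The squared modulus of a product of complex numbers is the product of the
    squared moduli; the addition formulas play the role of [e^(x+y) = e^x e^y]. *)
Lemma char_sum_step lam n :
  cos_sum lam n.+1 ^+ 2 + sin_sum lam n.+1 ^+ 2 =
  (cos_sum lam n ^+ 2 + sin_sum lam n ^+ 2) *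
  (cos_law (lam * n%:R) ^+ 2 + sin_law (lam * n%:R) ^+ 2).
Proof.
have det w w' : past eps n w = past eps n w' ->
    lam * weighted_sum n w = lam * weighted_sum n w'.
  by move=> /weighted_sum_past ->.
have WS w : lam * weighted_sum n.+1 w =
    lam * weighted_sum n w + lam * n%:R * xi n w.
  by rewrite /weighted_sum big_ord_recr /= mulrDr mulrA.
have [icc Ecc] := expect_trig_next (lam * n%:R) (@cos_max R) (@cos_max R) det.
have [iss Ess] := expect_trig_next (lam * n%:R) sin_max sin_max det.
have [ics Ecs] := expect_trig_next (lam * n%:R) (@cos_max R) sin_max det.
have [isc Esc] := expect_trig_next (lam * n%:R) sin_max (@cos_max R) det.
have -> : cos_sum lam n.+1 = cos_sum lam n * cos_law (lam * n%:R) -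
    sin_sum lam n * sin_law (lam * n%:R).
  rewrite /cos_sum; under eq_Rintegral do rewrite WS cosD.
  by rewrite expectB// Ecc Ess.
have -> : sin_sum lam n.+1 = sin_sum lam n * cos_law (lam * n%:R) +
    cos_sum lam n * sin_law (lam * n%:R).
  rewrite /sin_sum; under eq_Rintegral do rewrite WS sinD.
  by rewrite expectD// Esc Ecs.
by ring.
Qed.

(** The squared modulus of a characteristic function is the characteristic
    function of the difference of two independent copies. *)
Lemma char_law_symmetrized tau :
  cos_law tau ^+ 2 + sin_law tau ^+ 2 =
  \int[P]_w cos (tau * ((eps 0%N w)%:R - (eps 1%N w)%:R)).
Proof.
(* [xi_0] is the past before time 1 and [xi_1] the next innovation. *)
have det w w' : past eps 1 w = past eps 1 w' -> tau * xi 0%N w = tau * xi 0%N w'.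
  by move=> E; rewrite (past_eq E).
have [icc Ecc] := expect_trig_next tau (@cos_max R) (@cos_max R) det.
have [iss Ess] := expect_trig_next tau sin_max sin_max det.
have E0 g : (forall x, `|g x| <= 1) ->
    \int[P]_w g (tau * xi 0%N w) = \int[G]_k g (tau * (k%:R - mu)).
  move=> g1; apply: (law_expect (f := fun k => g (tau * (k%:R - mu))) 0%N law).
  exact: has_mean_law.
rewrite (E0 _ (@cos_max R)) in Ecc; rewrite (E0 _ sin_max) in Ess.
rewrite expr2 -[X in X + _]Ecc expr2 -[X in _ + X]Ess -expectD//.
apply: eq_Rintegral => w _; rewrite -cosB; congr cos; ring.
Qed.

(** The event that the two copies take the values [i] and [j] has probability
    [G i * G j], and on it the cosine falls short of 1 by [1 - cos (tau (i - j))]. *)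
Lemma char_law_le tau (i j : nat) : i != j ->
  cos_law tau ^+ 2 + sin_law tau ^+ 2 <=
  1 - fine (G [set i]) * fine (G [set j]) * (1 - cos (tau * (i%:R - j%:R))).
Proof.
move=> ij; rewrite char_law_symmetrized.
set A := fiber (eps 0%N) i `&` fiber (eps 1%N) j.
have mA : measurable A by apply: measurableI; exact: measurable_fiber_nat.
have [i1 E1] := expect_indic P mA.
have PA : fine (P A) = fine (G [set i]) * fine (G [set j]).
  rewrite -fineM ?fin_num_measure//; congr fine.
  rewrite (prob_past_next (n := 1) [set j] indep)//.
    by congr (_ * _)%E; [exact: (law 0%N)|exact: (law 1%N)].
  by move=> w w' E; rewrite /fiber/= (past_eq E).
rewrite -PA -E1 mulrC -expectZ// -[X in _ <= X - _](expect_cst P).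
rewrite -expectB; [|exact: has_mean_cst|exact: has_meanZ].
apply: le_expect.
- by apply: (has_mean_past (n := 2) (@cos_max R)) => w w' E; rewrite !(past_eq E).
- by apply: has_meanB; [exact: has_mean_cst|exact: has_meanZ].
- move=> w; rewrite indicE; case: (boolP (w \in A)).
    by rewrite inE => -[/= -> ->]; rewrite mulr1 subKr.
  by rewrite mulr0 subr0 cos_le1.
Qed.

End weighted_sum.

Lemma cos_anti {R : realType} (x y : R) :
  0 <= x -> x <= y -> y <= pi -> cos y <= cos x.
Proof.
move=> x0 xy ypi; rewrite leNgt ltr_cos ?in_itv/=; first by rewrite -leNgt.
- by rewrite (le_trans x0 xy).
- by rewrite x0 (le_trans xy ypi).
Qed.

Lemma pi_ge1 {R : realType} : 1 <= pi :> R.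
Proof. by rewrite (le_trans _ (pi_ge2 R))// ler1n. Qed.

Lemma ge_cos1 {R : realType} (x : R) : `|x| <= 1 -> cos 1 <= cos x.
Proof. by move=> x1; rewrite -(cos_norm x) cos_anti// pi_ge1. Qed.

(** The squared modulus of the sum of [e^(i k x)] for [k < L], expanded. *)
Lemma trig_sums_sqr {R : realType} (x : R) L :
  (\sum_(k < L) cos (k%:R * x)) ^+ 2 + (\sum_(k < L) sin (k%:R * x)) ^+ 2 =
  \sum_(k < L) \sum_(l < L) cos ((k%:R - l%:R) * x).
Proof.
rewrite !expr2 !mulr_suml -big_split; apply: eq_bigr => k _ /=.
rewrite !mulr_sumr -big_split; apply: eq_bigr => l _ /=.
by rewrite mulrBl cosB.
Qed.

Lemma trig_sums_ge {R : realType} (x : R) L :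
  (forall k, (k < L)%N -> `|k%:R * x| <= 1) ->
  (cos 1 * L%:R) ^+ 2 <= \sum_(k < L) \sum_(l < L) cos ((k%:R - l%:R) * x).
Proof.
move=> x1; rewrite -trig_sums_sqr; apply: ler_wpDr; first exact: sqr_ge0.
have c1 : 0 <= cos 1 * L%:R :> R by rewrite mulr_ge0// ltW// cos1_gt0.
suff le : cos 1 * L%:R <= \sum_(k < L) cos (k%:R * x).
  by rewrite ler_pXn2r// nnegrE (le_trans c1).
rewrite mulr_natr -[L in X in X <= _]card_ord -sumr_const.
by apply: ler_sum => k _; apply: ge_cos1; exact: x1.
Qed.

Section anticoncentration.
Context {d} {T : measurableType d} {R : realType} (P : probability T R)
  (G : probability nat R) (eps : nat -> {mfun T >-> nat}).
Context (indep : mutually_independent P eps)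
  (law : identically_distributed_as P eps G).

Local Notation W := (weighted_sum G eps).

(** Markov's inequality for the squared modulus of the sum of [e^(i k u W_n / n)].
    The diagonal of the double sum contributes [L], against the [L^2] gained on
    the event. *)
Lemma prob_weighted_sum_le n L (u A eta : R) :
  (0 < n)%N -> (0 < L)%N -> 0 < u -> L%:R * u * A <= 1 -> 0 <= eta ->
  (forall k l, (k < L)%N -> (l < L)%N -> k != l ->
    `|cos_sum P G eps ((k%:R - l%:R) * (u / n%:R)) n| <= eta) ->
  (P [set w | (`|W n w| <= A * n%:R)%R] <=
    ((L%:R^-1 + eta) / cos 1 ^+ 2)%:E)%E.
Proof.
move=> n0 L0 u0 LuA eta0 small.
pose F w := \sum_(k < L) \sum_(l < L)
  cos ((k%:R - l%:R) * (u / n%:R) * W n w).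
have FE w : F w = \sum_(k < L) \sum_(l < L)
    cos ((k%:R - l%:R) * (u / n%:R * W n w)).
  by apply: eq_bigr => k _; apply: eq_bigr => l _; rewrite -[LHS]/(cos _) -mulrA.
have kap0 : 0 < cos 1 :> R := cos1_gt0 R.
have c0 : 0 < (cos 1 * L%:R) ^+ 2 :> R by rewrite exprn_gt0// mulr_gt0// ltr0n.
have icos lam : has_mean P (fun w => cos (lam * W n w)).
  apply: (has_mean_past P (eps := eps) (n := n) (X := fun w => lam * W n w) (@cos_max R)).
  by move=> w w' E; rewrite (weighted_sum_past G E).
have [irow Erow] : (forall k, has_mean P (fun w => \sum_(l < L)
      cos ((k%:R - l%:R) * (u / n%:R) * W n w))) /\
    (forall k, \int[P]_w (\sum_(l < L)
      cos ((k%:R - l%:R) * (u / n%:R) * W n w)) =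
      \sum_(l < L) cos_sum P G eps ((k%:R - l%:R) * (u / n%:R)) n).
  by split=> k; case: (expect_sum (P := P) L
    (f := fun l w => cos ((k%:R - l%:R) * (u / n%:R) * W n w))).
have [iF EF] := expect_sum L irow.
have mF : measurable_fun [set: T] F.
  by apply/measurable_EFinP; exact: (measurable_int P).
have F0 w : 0 <= F w by rewrite FE -trig_sums_sqr addr_ge0// sqr_ge0.
apply: (@le_trans _ _ (P [set w | ((cos 1 * L%:R) ^+ 2 <= F w)%R])%E).
  apply: le_measure; rewrite ?inE.
  - rewrite -[X in measurable X]setTI; apply: measurable_fun_ler => //.
    by apply: measurableT_comp => //; exact: measurable_weighted_sum.
  - by rewrite -[X in measurable X]setTI; exact: measurable_fun_ler.
  - move=> w /= Ww; rewrite FE; apply: trig_sums_ge => k kL.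
    rewrite normrM ger0_norm// normrM ger0_norm; last by rewrite divr_ge0// ltW.
    apply: le_trans LuA; rewrite -[L%:R * u * A]mulrA; apply: ler_pM => //.
    + by rewrite mulr_ge0// divr_ge0// ltW.
    + by rewrite ler_nat ltnW.
    + rewrite -mulrA ler_pM2l// mulrC ler_pdivrMr// ltr0n//.
apply: (le_trans (markov_ge0 P mF F0 c0)).
have -> : (\int[P]_w (F w)%:E = (\int[P]_w F w)%:E)%E.
  by rewrite /Rintegral fineK//; exact: integrable_fin_num.
rewrite -EFinM lee_fin /F EF.
under eq_bigr do rewrite Erow.
have row (k : 'I_L) : \sum_(l < L)
    cos_sum P G eps ((k%:R - l%:R) * (u / n%:R)) n <= 1 + L%:R * eta.
  rewrite (bigD1 k)//=; apply: lerD.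
    rewrite subrr mul0r /cos_sum; under eq_Rintegral do rewrite mul0r cos0.
    by rewrite expect_cst.
  apply: (@le_trans _ _ (\sum_(l < L | l != k) eta)).
    apply: ler_sum => l lk; apply: (le_trans (ler_norm _)).
    by apply: small => //; rewrite eq_sym.
  apply: (@le_trans _ _ (\sum_(l < L) eta)).
    by rewrite big_mkcond; apply: ler_sum => l _; case: ifP.
  by rewrite sumr_const card_ord mulr_natl.
apply: (@le_trans _ _ ((cos 1 * L%:R) ^- 2 * \sum_(k < L) (1 + L%:R * eta))).
  apply: ler_wpM2l; first by rewrite invr_ge0 ltW.
  by apply: ler_sum => k _; exact: row.
rewrite sumr_const card_ord -mulr_natl le_eqVlt; apply/orP; left; apply/eqP.
field; rewrite gt_eqF//= gt_eqF// ltr0n//.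
Qed.

(** Factors with index below [h] are bounded by 1, the others by [q]. *)
Lemma char_sum_decay (lam q : R) h n : 0 <= q ->
  (forall m, (h <= m < n)%N ->
    cos_law G (lam * m%:R) ^+ 2 + sin_law G (lam * m%:R) ^+ 2 <= q) ->
  `|cos_sum P G eps lam n| ^+ 2 <= q ^+ (n - h).
Proof.
move=> q0 small.
have law1 tau : 0 <= cos_law G tau ^+ 2 + sin_law G tau ^+ 2 <= 1.
  rewrite addr_ge0 ?sqr_ge0//=.
  rewrite (char_law_symmetrized indep law) -[X in _ <= X](expect_cst P).
  apply: le_expect; [|exact: has_mean_cst|by move=> w; exact: cos_le1].
  by apply: (has_mean_past P (eps := eps) (n := 2) (@cos_max R)) => w w' E; rewrite !(past_eq E).
rewrite real_normK ?num_real//.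
suff : forall m, (m <= n)%N ->
    cos_sum P G eps lam m ^+ 2 + sin_sum P G eps lam m ^+ 2 <= q ^+ (m - h).
  by move=> /(_ n (leqnn n)); apply: le_trans; rewrite lerDl sqr_ge0.
elim=> [_|m IH mn].
  rewrite sub0n expr0 /cos_sum /sin_sum /weighted_sum.
  under eq_Rintegral do rewrite big_ord0 mulr0 cos0.
  under [X in _ + X ^+ 2]eq_Rintegral do rewrite big_ord0 mulr0 sin0.
  by rewrite !expect_cst expr1n expr0n addr0.
rewrite (char_sum_step indep law).
have /andP[l0 l1] := law1 (lam * m%:R).
have [hm|mh] := leqP h m.
  rewrite subSn// [q ^+ _.+1]exprSr; apply: ler_pM => //.
  - by rewrite addr_ge0 ?sqr_ge0.
  - by apply: IH; exact: ltnW.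
  - by apply: small; rewrite hm.
have -> : (m.+1 - h = m - h)%N by lia.
rewrite -[X in _ <= X]mulr1; apply: ler_pM => //.
- by rewrite addr_ge0 ?sqr_ge0.
- by apply: IH; exact: ltnW.
Qed.

End anticoncentration.

(** * Anti-concentration of the weighted sum *)

Lemma dist_nat_ge1 {R : realType} (k l : nat) : k != l -> 1 <= `|k%:R - l%:R : R|.
Proof.
wlog kl : k l / (k < l)%N.
  move=> H kl; have [|] := ltnP k l; first by move=> /H; apply.
  by rewrite leq_eqVlt eq_sym (negbTE kl)/= => /H; rewrite distrC; apply; rewrite eq_sym.
by move=> _; rewrite distrC -natrB 1?ltnW// ger0_norm// ler1n subn_gt0.
Qed.

Lemma dist_nat_le {R : realType} (k l L : nat) : (k < L)%N -> (l < L)%N ->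
  `|k%:R - l%:R : R| <= L%:R.
Proof.
move=> kL lL; have kL' : k%:R <= L%:R :> R by rewrite ler_nat ltnW.
have lL' : l%:R <= L%:R :> R by rewrite ler_nat ltnW.
have k0 : 0 <= k%:R :> R by []. have l0 : 0 <= l%:R :> R by [].
by rewrite ler_norml; apply/andP; split; lra.
Qed.

Lemma exists_expr_le {R : realType} (q e : R) : 0 <= q < 1 -> 0 < e ->
  exists N, q ^+ N <= e.
Proof.
move=> /andP[q0 q1] e0.
have /cvgrPdist_le/(_ _ e0)[N _ /(_ N (leqnn N))] : q ^+ n @[n --> \oo] --> 0.
  by apply: cvg_expr; rewrite ger0_norm.
by rewrite sub0r normrN ger0_norm ?exprn_ge0//; exists N.
Qed.

(** The integer [n0] does not depend on the probability [P], which is essential: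
    in the application the probability varies with [n]. *)
Lemma anticoncentration {d} {T : measurableType d} {R : realType}
    (G : probability nat R) (eps : nat -> {mfun T >-> nat}) (i j : nat) (A delta : R) :
  i != j -> 0 < fine (G [set i]) -> 0 < fine (G [set j]) -> 0 <= A -> 0 < delta ->
  exists n0, forall n, (n0 <= n)%N -> forall P : probability T R,
    mutually_independent P eps -> identically_distributed_as P eps G ->
    (P [set w | (`|weighted_sum G eps n w| <= A * n%:R)%R] <= delta%:E)%E.
Proof.
move=> ij gi gj A0 delta0.
have kap0 : 0 < cos 1 :> R := cos1_gt0 R.
pose D : R := `|i%:R - j%:R|.
have D1 : 1 <= D by exact: dist_nat_ge1.
have D0 : 0 < D by exact: lt_le_trans D1.
pose eta := delta * cos 1 ^+ 2 / 2.
have eta0 : 0 < eta by rewrite divr_gt0// mulr_gt0// exprn_gt0.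
(* [L] makes the diagonal contribution [1 / (L (cos 1)^2)] at most [delta / 2]. *)
pose L := (Num.truncn eta^-1).+1.
have L0 : 0 < L%:R :> R by rewrite ltr0n.
have Leta : L%:R^-1 <= eta.
  rewrite -[leRHS]invrK lef_pV2 ?posrE ?invr_gt0// ltW//.
  exact: truncnS_gt.
(* [u] is small enough both for [k u |W_n| / n <= 1] on the event and for the angles
   [(k - l) u m D / n] to stay below 1, where the cosine is decreasing. *)
pose u := (L%:R * (D + A))^-1.
have DA0 : 0 < D + A by rewrite ltr_wpDr.
have u0 : 0 < u by rewrite invr_gt0 mulr_gt0.
have LuA : L%:R * u * A <= 1.
  rewrite /u invfM mulrA divff ?gt_eqF// mul1r mulrC ler_pdivrMr// mul1r.
  by rewrite lerDr ltW.
have LuD : L%:R * u * D <= 1.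
  rewrite /u invfM mulrA divff ?gt_eqF// mul1r mulrC ler_pdivrMr// mul1r.
  by rewrite lerDl.
have L1 : 1 <= L%:R :> R by rewrite ler1n.
have uD : u * D <= 1.
  by apply: le_trans LuD; rewrite -mulrA ler_peMl// mulr_ge0// ltW.
have uD0 : 0 < u * D by rewrite mulr_gt0.
(* For [m >= n / 2] the angle is at least [u D / 2], so the factor is at most [1 - c]. *)
pose c := fine (G [set i]) * fine (G [set j]) * (1 - cos (u * D / 2)).
have cosy0 : 0 <= cos (u * D / 2).
  apply: le_trans (ltW kap0) _; apply: ge_cos1; rewrite ger0_norm; lra.
have cosy1 : cos (u * D / 2) < 1.
  have y0 : 0 < u * D / 2 by lra.
  have ypi : u * D / 2 <= pi by apply: le_trans (@pi_ge1 R); lra.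
  by rewrite -[X in _ < X]cos0 ltr_cos ?in_itv/= ?lexx ?pi_ge0// (ltW y0) ypi.
have g1 k : fine (G [set k]) <= 1.
  by rewrite -lee_fin fineK ?fin_num_measure// probability_le1.
have c01 : 0 < c <= 1.
  rewrite /c !mulr_gt0 ?subr_gt0//=.
  rewrite -[leRHS]mul1r ler_pM ?mulr_ge0 ?subr_ge0 ?(ltW gi) ?(ltW gj) ?(ltW cosy1)//.
    by rewrite -[leRHS]mul1r ler_pM ?(ltW gi) ?(ltW gj).
  by rewrite gerBl.
pose q := 1 - c.
have q01 : 0 <= q < 1 by case/andP: c01 => c0 c1; rewrite /q; apply/andP; split; lra.
have /andP[q0 q1] := q01.
have [N qN] : exists N, q ^+ N <= eta ^+ 2.
  by apply: exists_expr_le => //; rewrite exprn_gt0.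
exists (N.*2.+1) => n Nn P indep law.
have n0 : (0 < n)%N by exact: leq_trans Nn.
have nR0 : 0 < n%:R :> R by rewrite ltr0n.
apply: (@le_trans _ _ ((L%:R^-1 + eta) / cos 1 ^+ 2)%:E); last first.
  rewrite lee_fin ler_pdivrMr ?exprn_gt0//; apply: (@le_trans _ _ (eta + eta)).
    by rewrite lerD2r.
  by rewrite /eta; lra.
apply: (prob_weighted_sum_le n0 _ u0 LuA (ltW eta0)) => // k l kL lL kl.
suff : `|cos_sum P G eps ((k%:R - l%:R) * (u / n%:R)) n| ^+ 2 <= eta ^+ 2.
  by rewrite ler_pXn2r// nnegrE// ltW.
apply: (le_trans _ qN).
apply: (@le_trans _ _ (q ^+ (n - uphalf n))); last first.
  by apply: ler_wiXn2l => //; [exact: ltW|clear -Nn; lia].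
apply: (char_sum_decay indep law) => // m /andP[hm mn].
apply: (le_trans (char_law_le indep law _ ij)).
rewrite /q lerD2l lerN2 /c ler_wpM2l// ?mulr_ge0 ?(ltW gi) ?(ltW gj)//.
rewrite lerD2l lerN2 -[leLHS]cos_norm.
have kl1 : 1 <= `|k%:R - l%:R : R| by exact: dist_nat_ge1.
have klL : `|k%:R - l%:R : R| <= L%:R by exact: dist_nat_le.
have mn2 : n%:R <= 2 * m%:R :> R by rewrite -natrM ler_nat; clear -hm; lia.
have mn1 : m%:R <= n%:R :> R by rewrite ler_nat ltnW.
have -> : `|(k%:R - l%:R) * (u / n%:R) * m%:R * (i%:R - j%:R)| =
    `|k%:R - l%:R| * (u * D * (m%:R / n%:R)).
  by rewrite !normrM -/D (normfV n%:R) !normr_nat (ger0_norm (ltW u0)); ring.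
have mn_ge : 2^-1 <= m%:R / n%:R :> R by rewrite ler_pdivlMr//; lra.
have mn_le : m%:R / n%:R <= 1 :> R by rewrite ler_pdivrMr// mul1r.
have mn0 : 0 <= m%:R / n%:R :> R by rewrite divr_ge0.
apply: cos_anti.
- by rewrite divr_ge0// ltW.
- rewrite -[leLHS]mul1r; apply: ler_pM => //; first by rewrite divr_ge0// ltW.
  by rewrite ler_wpM2l// ltW.
- apply: (le_trans _ (@pi_ge1 R)); apply: le_trans LuD.
  rewrite -[leRHS]mulrA; apply: ler_pM => //; first by rewrite mulr_ge0// ltW.
  by rewrite -[leRHS]mulr1 ler_wpM2l// ltW.
Qed.

(** * Atoms of the innovation law *)

Lemma null_atoms {R : realType} (G : probability nat R) (A : set nat) :
  (forall k, A k -> G [set k] = 0%E) -> G A = 0%E.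
Proof.
move=> A0; rewrite -(bigcup_slice id A) measure_bigcup//; last exact: trivIset_slice.
apply: eseries0 => i _ _; have [[k [Ak ik]]|no] := pselect (slice id A i !=set0).
  suff -> : slice id A i = [set k] by exact: A0.
  apply/seteqP; split => [l [_ /= il]|l /= ->//].
  by apply: (pcan_inj choice.pickleK); rewrite il ik.
suff -> : slice id A i = set0 by rewrite measure0.
by apply/seteqP; split => // k kA; apply: no; exists k.
Qed.

(** A law without two atoms of positive mass would put mass 0 or 1 on a single
    point and mass 0 on all others, that is total mass 0 or a Dirac mass. *)
Lemma two_atoms {R : realType} (G : probability nat R) :
  (forall k, G [set k] != 1%E) ->
  exists i j, [/\ i != j, 0 < fine (G [set i]) & 0 < fine (G [set j])].
Proof.
move=> nondeg.
have pos k : G [set k] <> 0%E -> 0 < fine (G [set k]).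
  move=> /eqP Gk; rewrite fine_gt0// lt0e Gk measure_ge0/=.
  by rewrite (le_lt_trans (probability_le1 _ _)) ?ltry.
have [i Gi] : exists i, G [set i] <> 0%E.
  apply: contrapT => no; have : G setT = 0%E.
    by apply: null_atoms => k _; apply: contrapT => Gk; apply: no; exists k.
  by rewrite probability_setT => /eqP; rewrite onee_eq0.
have [j [ji Gj]] : exists j, j != i /\ G [set j] <> 0%E.
  apply: contrapT => no; have := nondeg i; apply/negP; rewrite negbK; apply/eqP.
  rewrite -[LHS]adde0 -[X in (_ + X)%E](@null_atoms _ G (~` [set i])).
    rewrite -measureU//; last by rewrite setICr.
    by rewrite setUCr; exact: probability_setT.
  move=> k /= ki; apply: contrapT => Gk; apply: no; exists k; split => //.
  exact/eqP.
by exists i, j; split; rewrite 1?eq_sym//; exact: pos.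
Qed.

(** One of two distinct atoms is positive. *)
Lemma mean_gt0 {R : realType} (G : probability nat R) :
  (forall k, G [set k] != 1%E) -> has_mean G (fun k => k%:R) -> 0 < mean_of G.
Proof.
move=> nondeg G1; have [i [j [ij gi gj]]] := two_atoms nondeg.
have [k k0 gk] : exists2 k, (0 < k)%N & 0 < fine (G [set k]).
  have [i0|i0] := posnP i; last by exists i.
  by exists j => //; rewrite lt0n eq_sym -i0.
have [ik Ek] := expect_indic G (A := [set k]) Logic.I.
apply: (@lt_le_trans _ _ (k%:R * \int[G]_l \1_[set k] l)).
  by rewrite Ek mulr_gt0// ltr0n.
rewrite -expectZ//; apply: le_expect => //; first exact: has_meanZ.
move=> l; rewrite indicE; case: (boolP (l \in [set k])); last by rewrite mulr0.
by rewrite inE => ->; rewrite mulr1.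
Qed.

(** * The estimator along one trajectory *)

(** Here [x], [e] and [D] are the population sizes, innovations and deaths along a
    fixed trajectory. *)
Section ols_deterministic.
Context {R : realType} (mu : R) (x e D : nat -> nat).
Context (x0 : x 0%N = 0%N) (xS : forall t, (x t.+1 + D t = x t + e t)%N).

Local Notation S n := (\sum_(t < n) e t)%N.
Local Notation C n := (\sum_(t < n) D t)%N.
Local Notation xi t := ((e t)%:R - mu).
Local Notation M n := (\sum_(t < n) xi t).
Local Notation num n := (\sum_(t < n) (x t)%:R * ((x t.+1)%:R - (x t)%:R - mu)).
Local Notation den n := (\sum_(t < n) (x t)%:R ^+ 2 : R).

Lemma state_decomp n : (x n + C n = S n)%N.
Proof.
elim: n => [|n IH]; first by rewrite !big_ord0 x0.
by rewrite !big_ord_recr /= -IH addnCA xS addnCA addnA.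
Qed.

Lemma state_real t : (x t)%:R = t%:R * mu + M t - (C t)%:R :> R.
Proof.
have := congr1 (fun k => k%:R : R) (state_decomp t); rewrite natrD => xE.
rewrite sumrB -natr_sum -xE sumr_const card_ord -[mu *+ t]mulr_natl; ring.
Qed.

Lemma num_decomp n :
  num n = mu * \sum_(t < n) t%:R * xi t + \sum_(t < n) M t * xi t
          - \sum_(t < n) (C t)%:R * xi t - \sum_(t < n) (x t)%:R * (D t)%:R.
Proof.
rewrite mulr_sumr -big_split -!sumrB; apply: eq_bigr => t _ /=.
have xSr : (x t.+1)%:R = (x t)%:R + (e t)%:R - (D t)%:R :> R.
  by rewrite -natrD -xS natrD addrK.
rewrite xSr; have := state_real t; move: (x t)%:R => X XE.
rewrite [X in LHS]XE; rewrite [X in X * (D t)%:R]XE; ring.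
Qed.

Lemma leq_sums (f : nat -> nat) t n : (t <= n)%N ->
  (\sum_(s < t) f s <= \sum_(s < n) f s)%N.
Proof.
move=> tn; rewrite -(subnKC tn) big_split_ord /=; exact: leq_addr.
Qed.

(** Since [C] is nondecreasing and [x] is bounded by [S], the two sums
    involving deaths are at most [C n] times a sum of order [n]. *)
Lemma num_approx n : 0 <= mu ->
  `|num n - mu * \sum_(t < n) t%:R * xi t| <=
  `|\sum_(t < n) M t * xi t| + (C n)%:R * ((S n)%:R + n%:R * mu)
   + (S n)%:R * (C n)%:R.
Proof.
move=> mu0; rewrite num_decomp.
set a := mu * _; set b := \sum_(t < n) M t * _; set c := \sum_(t < n) (C t)%:R * _.
set f := \sum_(t < n) _.
have -> : a + b - c - f - a = b - c - f by ring.
apply: (le_trans (ler_normB _ _)); apply: lerD.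
  apply: (le_trans (ler_normB _ _)); rewrite lerD2l.
  apply: (le_trans (ler_norm_sum _ _ _)).
  have -> : (S n)%:R + n%:R * mu = \sum_(t < n) ((e t)%:R + mu).
    by rewrite big_split/= natr_sum sumr_const card_ord mulr_natl.
  rewrite mulr_sumr; apply: ler_sum => t _; rewrite normrM normr_nat.
  apply: ler_pM => //; first by rewrite ler_nat leq_sums// ltnW.
  by rewrite (le_trans (ler_normB _ _))// normr_nat ger0_norm.
rewrite ger0_norm; last by apply: sumr_ge0 => t _; rewrite mulr_ge0.
rewrite [(C n)%:R]natr_sum mulr_sumr; apply: ler_sum => t _.
apply: ler_wpM2r => //; rewrite ler_nat.
by rewrite (leq_trans _ (leq_sums e (ltnW (ltn_ord t))))// -state_decomp leq_addr.
Qed.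

Lemma den_le n : den n <= n%:R * (S n)%:R ^+ 2.
Proof.
apply: (@le_trans _ _ (\sum_(t < n) (S n)%:R ^+ 2)).
  apply: ler_sum => t _; rewrite ler_pXn2r// ?nnegrE// ler_nat.
  by rewrite (leq_trans _ (leq_sums e (ltnW (ltn_ord t))))// -state_decomp leq_addr.
by rewrite sumr_const card_ord mulr_natl.
Qed.

(** If the denominator vanishes then so do all states, hence also the numerator;
    the convention for division by zero therefore never matters on the event of
    interest. *)
Lemma den_gt0 n : num n != 0 -> 0 < den n.
Proof.
apply: contra_neqT; rewrite -leNgt => d0.
have /psumr_eq0P den0 : den n = 0.
  by apply/eqP; rewrite eq_le d0 sumr_ge0// => t _; exact: sqr_ge0.
apply: big1 => t _; suff -> : (x t)%:R = 0 :> R by rewrite mul0r.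
by apply/eqP; rewrite -sqrf_eq0; apply/eqP; exact: den0.
Qed.

(** On the good event the numerator exceeds [K A^2 n] in absolute value while the
    denominator is at most [A^2 n^3]. *)
Lemma h_ols_large n (K A B : R) :
  (0 < n)%N -> 0 < mu -> 0 <= K -> 0 < A ->
  (S n)%:R <= A * n%:R -> (C n)%:R <= A ->
  `|\sum_(t < n) M t * xi t| <= A * n%:R ->
  K * A ^+ 2 + A + 2 * A ^+ 2 + A * mu <= mu * B ->
  B * n%:R < `|\sum_(t < n) t%:R * xi t| ->
  K < `|h_ols mu n x|.
Proof.
move=> n0 mu_gt0 K0 A0 SA CA MA muB BW; have mu0 := ltW mu_gt0.
have nR : 0 < n%:R :> R by rewrite ltr0n.
set W := \sum_(t < n) t%:R * xi t in BW.
have numW : K * A ^+ 2 * n%:R < `|num n|.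
  have := num_approx n mu0; rewrite -/W => approx.
  have W_le : mu * `|W| <= `|num n| + `|num n - mu * W|.
    rewrite -[mu in leLHS]ger0_norm// -normrM.
    by rewrite -{1}[mu * W](subKr (num n)) ler_normB.
  have muW : mu * B * n%:R < mu * `|W| by rewrite -mulrA ltr_pM2l.
  have muBn : (K * A ^+ 2 + A + 2 * A ^+ 2 + A * mu) * n%:R <= mu * B * n%:R.
    by rewrite ler_pM2r.
  have CS : (C n)%:R * ((S n)%:R + n%:R * mu) <= A * (A * n%:R + n%:R * mu).
    by apply: ler_pM => //; [rewrite addr_ge0// mulr_ge0|rewrite lerD2r].
  have SC : (S n)%:R * (C n)%:R <= A * n%:R * A by apply: ler_pM.
  move: approx MA W_le muW muBn CS SC.
  move: `|num n| `|num n - _| `|W| `|\sum_(t < n) M t * _|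
    ((C n)%:R * _) ((S n)%:R * _) (mu * B * n%:R) => a b c f g k l.
  by move=> h1 h2 h3 h4 h5 h6 h7; nra.
have num0 : num n != 0.
  by rewrite -normr_gt0 (le_lt_trans _ numW)// !mulr_ge0 ?exprn_ge0// ltW.
have d0 := den_gt0 num0.
rewrite /h_ols normrN normrM normrM normfV (ger0_norm (ltW d0)).
rewrite ger0_norm ?exprn_ge0// ltr_pdivlMr//.
apply: (@le_lt_trans _ _ (n%:R ^+ 2 * (K * A ^+ 2 * n%:R))).
  have -> : n%:R ^+ 2 * (K * A ^+ 2 * n%:R) = K * (n%:R * (A * n%:R) ^+ 2) by ring.
  apply: ler_wpM2l => //; apply: (le_trans (den_le n)).
  by rewrite ler_pM2l// ler_pXn2r// nnegrE// mulr_ge0// ltW.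
by rewrite ltr_pM2l// exprn_gt0.
Qed.

End ols_deterministic.

(** * Probability of a large estimate *)

Section inar1_paths.
Context {d} {T : measurableType d} (Z : nat * nat -> {mfun T >-> bool})
  (eps : nat -> {mfun T >-> nat}).

Local Notation X := (inar1 Z eps).

Definition deaths (t : nat) (w : T) : nat :=
  (\sum_(j < X t w) ~~ Z (t : nat, j : nat) w)%N.

Lemma inar1_balance t w : (X t.+1 w + deaths t w = X t w + eps t w)%N.
Proof.
rewrite /deaths /= addnAC -big_split /= (eq_bigr (fun=> 1%N)).
  by rewrite sum1_card card_ord.
by move=> j _; case: (Z _ w).
Qed.

(** The population never exceeds the number of innovations so far. *)
Lemma sum_deaths_le n w :
  (\sum_(t < n) deaths t w <= death_bound Z eps n w)%N.
Proof.
apply: leq_sum => t _; rewrite /deaths.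
have XS : (X t w <= innov_sum eps t w)%N.
  have := @state_decomp (X^~ w) (eps^~ w) (deaths^~ w) erefl
    (fun t => inar1_balance t w) t.
  by rewrite /innov_sum => <-; exact: leq_addr.
exact: (@leq_sums (fun j => nat_of_bool (~~ Z (t : nat, j) w))).
Qed.

(** Conditioning on the number of summands [m] turns the thinning into a sum over
    a fixed index set, which is a function of finitely many discrete variables. *)
Lemma measurable_fiber_inar1 t k : measurable (fiber (X t) k).
Proof.
elim: t k => [|t IH] k.
  apply: (measurable_determined (V := fun=> tt)) => // -[].
  by rewrite (_ : fiber _ _ = setT)//; apply/seteqP; split.
pose F m : set T := [set w | (\sum_(j < m) Z (t, j : nat) w + eps t w)%N = k].
have -> : fiber (X t.+1) k = \bigcup_m (fiber (X t) m `&` F m).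
  apply/seteqP; split => [w Xw|w [m _ [/= Xw Fw]]].
    by exists (X t w).
  by rewrite /fiber /= Xw.
apply: bigcup_measurable => m _; apply: measurableI; first exact: IH.
apply: (measurable_determined
    (V := fun w => (past (fun j => Z (t, j)) m w, eps t w))) => [[s l]|w w'].
  rewrite fiber_pair; apply: measurableI; last exact: measurable_fiber_nat.
  apply: (measurable_fiber_mkseq false) => j b.
  exact: (measurable_funPTI (Z (t, j)) (Y := [set b])).
move=> [E El]; rewrite /F /= El => <-; congr (_ + _)%N.
by apply: eq_bigr => j _; rewrite (past_eq (X := fun j => Z (t, j)) E).
Qed.

Lemma measurable_h_ols_gt {R : realType} (mu K : R) n :
  measurable [set w | K < `|h_ols mu n (fun t => X t w)|].
Proof.
apply: (measurable_determined
  (measurable_fiber_mkseq 0%N n.+1 measurable_fiber_inar1)) => w w' E /=.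
suff -> : h_ols mu n (X^~ w) = h_ols mu n (X^~ w') by [].
have XE i : (i <= n)%N -> X i w = X i w' := past_eq E (i := i).
rewrite /h_ols; congr (- (_ * _ / _)).
  by apply: eq_bigr => t _; rewrite !XE// ltnW.
by apply: eq_bigr => t _; rewrite XE// ltnW.
Qed.

End inar1_paths.

(** Outside four bad events, three of which are handled by Markov's inequality and
    the fourth by the premise on the weighted sum, the estimate is large. *)
Lemma prob_h_ols_gt {d} {T : measurableType d} {R : realType}
    (P : probability T R) (theta : R) (G : probability nat R)
    (Z : nat * nat -> {mfun T >-> bool}) (eps : nat -> {mfun T >-> nat})
    (n : nat) (K A B : R) (delta1 delta2 : R) :
  inar1_inputs P theta G Z eps -> 0 <= theta <= 1 ->
  has_mean G (fun k => k%:R) -> has_mean G (fun k => k%:R ^+ 2) ->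
  0 < mean_of G -> (0 < n)%N -> 0 <= K -> 0 < A ->
  K * A ^+ 2 + A + 2 * A ^+ 2 + A * mean_of G <= mean_of G * B ->
  mean_of G + (1 - theta) * n%:R ^+ 2 * mean_of G + 2 * variance_of G <= delta1 * A ->
  (P [set w | (`|weighted_sum G eps n w| <= B * n%:R)%R] <= delta2%:E)%E ->
  ((1 - (delta1 + delta2))%:E <=
   P [set w | (K < `|h_ols (mean_of G) n (fun t => inar1 Z eps t w)|)%R])%E.
Proof.
move=> model theta01 G1 G2 mu0 n0 K0 A0 KAB Adelta PW.
have nR : 0 < n%:R :> R by rewrite ltr0n.
set mu := mean_of G in mu0 KAB Adelta PW *.
set good := [set w | _].
have mgood : measurable good by exact: measurable_h_ols_gt.
have indep := innovation_indep model; have law := innovation_law model.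
have [iS ES] := expect_innov_sum indep law G1 G2 n.
have [iQ EQ] := expect_quadratic_sum indep law G1 G2 n.
have EC := expect_death_bound model theta01 G1 G2 n.
have mS : measurable_fun [set: T] (fun w => (innov_sum eps n w)%:R : R).
  by apply/measurable_EFinP; exact: (measurable_int P).
have mQ : measurable_fun [set: T] (quadratic_sum G eps n).
  by apply/measurable_EFinP; exact: (measurable_int P).
have mC := measurable_death_bound (R := R) Z eps n.
have fromR (f : T -> R) : has_mean P f -> (\int[P]_w (f w)%:E = (\int[P]_w f w)%:E)%E.
  by move=> mf; rewrite /Rintegral fineK//; exact: integrable_fin_num.
pose B1 := [set w | A * n%:R <= (innov_sum eps n w)%:R].
pose B2 := [set w | A <= (death_bound Z eps n w)%:R].
pose B3 := [set w | A * n%:R <= quadratic_sum G eps n w].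
pose B4 := [set w | `|weighted_sum G eps n w| <= B * n%:R].
have mB1 : measurable B1 by rewrite -[B1]setTI; exact: measurable_fun_ler.
have mB2 : measurable B2 by rewrite -[B2]setTI; exact: measurable_fun_ler.
have mB3 : measurable B3 by rewrite -[B3]setTI; exact: measurable_fun_ler.
have mB4 : measurable B4.
  rewrite -[B4]setTI; apply: measurable_fun_ler => //.
  by apply: measurableT_comp => //; exact: measurable_weighted_sum.
have An0 : 0 < A * n%:R by rewrite mulr_gt0.
have P1 : (P B1 <= (mu / A)%:E)%E.
  apply: (le_trans (markov_ge0 P mS _ An0)) => //.
  rewrite fromR// ES -/mu -EFinM lee_fin le_eqVlt; apply/orP; left; apply/eqP.
  by field; rewrite !gt_eqF.
have P2 : (P B2 <= ((1 - theta) * n%:R ^+ 2 * mu / A)%:E)%E.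
  apply: (le_trans (markov_ge0 P mC _ A0)) => //.
  apply: (@le_trans _ _ (A^-1%:E * ((1 - theta) * (n%:R ^+ 2 * mu))%:E)%E).
    by rewrite lee_wpmul2l// lee_fin invr_ge0 ltW.
  by rewrite -EFinM lee_fin mulrC !mulrA.
have P3 : (P B3 <= (2 * variance_of G / A)%:E)%E.
  apply: (le_trans (markov_ge0 P mQ _ An0)) => [w|].
    by rewrite addr_ge0 ?sqr_ge0// sumr_ge0// => t _; exact: sqr_ge0.
  rewrite fromR// EQ -EFinM lee_fin le_eqVlt; apply/orP; left; apply/eqP.
  by field; rewrite !gt_eqF.
have cover : ~` good `<=` B1 `|` B2 `|` B3 `|` B4.
  move=> w; apply: contra_notP => /not_orP[/not_orP[/not_orP[]]].
  move=> /negP nB1 /negP nB2 /negP nB3 /negP nB4.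
  rewrite -!ltNge in nB1 nB2 nB3 nB4.
  rewrite /good /=; apply: (@h_ols_large _ mu (inar1 Z eps ^~ w) (eps^~ w)
    (deaths Z eps ^~ w) erefl (fun t => inar1_balance Z eps t w) n K A B) => //.
  - exact: ltW nB1.
  - by apply: le_trans (ltW nB2); rewrite ler_nat; exact: sum_deaths_le.
  - apply: le_trans (ltW nB3).
    have := martingale_sum G eps n w; rewrite /quadratic_sum -/mu /centered_sum.
    set V := \sum_(t < n) _ * _; set Q := \sum_(t < n) _ ^+ 2; set M := \sum_(t < n) _.
    have Q0 : 0 <= Q by apply: sumr_ge0 => t _; exact: sqr_ge0.
    have M0 : 0 <= M ^+ 2 by exact: sqr_ge0.
    move: Q0 M0; move: (M ^+ 2) Q V => M2 Q V Q0 M0 VE.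
    by rewrite ler_norml; apply/andP; split; lra.
have -> : P good = (1 - P (~` good))%E by rewrite -probability_setC ?setCK//; exact: measurableC.
rewrite EFinB; apply: leeB => //.
have mU2 : measurable (B1 `|` B2) by exact: measurableU.
have mU3 : measurable (B1 `|` B2 `|` B3) by exact: measurableU.
apply: (@le_trans _ _ (P (B1 `|` B2 `|` B3 `|` B4))).
  by apply: le_measure; rewrite ?inE//; [exact: measurableC|exact: measurableU].
apply: (le_trans (measureU2 _ mU3 mB4)).
rewrite EFinD; apply: leeD => //.
apply: (le_trans (measureU2 _ mU2 mB3)).
apply: (@le_trans _ _ ((mu / A + (1 - theta) * n%:R ^+ 2 * mu / A)%:E +
    (2 * variance_of G / A)%:E)%E).
  apply: leeD => //; apply: (le_trans (measureU2 _ mB1 mB2)).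
  by rewrite EFinD; exact: leeD.
by rewrite -EFinD lee_fin -!mulrDl ler_pdivrMr.
Qed.

(** * Divergence of the estimator *)

Lemma theta_in_unit {R : realType} (h : R) : 0 <= h ->
  \forall n \near \oo, 0 <= 1 - h / n%:R ^+ 2 <= 1.
Proof.
move=> h0; exists (Num.truncn h).+1 => // n /= hn.
have hn' : h <= n%:R by rewrite (le_trans (ltW (truncnS_gt h)))// ler_nat.
have n1 : 1 <= n%:R :> R by rewrite ler1n (leq_trans _ hn).
have n20 : 0 < n%:R ^+ 2 :> R by rewrite exprn_gt0// (lt_le_trans ltr01).
rewrite lerBlDr lerDl divr_ge0 ?(ltW n20)// andbT subr_ge0 ler_pdivrMr// mul1r.
by rewrite (le_trans hn')// expr2 ler_peMl// (le_trans ler01).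
Qed.

Theorem proposition4p3 (R : realType) (G : probability nat R)
    (G_nondegenerate : forall k : nat, G [set k] != 1%E)
    (G_moment3 : ('E_G[(fun k : nat => k%:R ^+ 3 : R)%R] < +oo)%E)
    (d : measure_display) (T : measurableType d)
    (P : R -> probability T R)
    (Z : nat * nat -> {mfun T >-> bool}) (eps : nat -> {mfun T >-> nat})
    (model : forall theta : R, 0 <= theta <= 1 ->
       inar1_inputs (P theta) theta G Z eps)
    (h : R) (h_ge0 : 0 <= h) (K : R) :
  P (1 - h / n%:R ^+ 2)
    [set w | K < `|h_ols (mean G) n (fun t => inar1 Z eps t w)|]
    @[n --> \oo] --> 1%E.
Proof.
have G1 : has_mean G (fun k => k%:R) := integrable_pow_le3 (p := 1) G_moment3 isT.
have G2 : has_mean G (fun k => k%:R ^+ 2) := integrable_pow_le3 (p := 2) G_moment3 isT.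
have -> : mean G = mean_of G by rewrite /mean unlock.
have mu0 := mean_gt0 G_nondegenerate G1.
have [i [j [ij gi gj]]] := two_atoms G_nondegenerate.
pose E n := [set w | K < `|h_ols (mean_of G) n (fun t => inar1 Z eps t w)|].
have finP n : P (1 - h / n%:R ^+ 2) (E n) \is a fin_num.
  by apply: fin_num_measure; exact: measurable_h_ols_gt.
suff fineP : fine (P (1 - h / n%:R ^+ 2) (E n)) @[n --> \oo] --> (1 : R).
  by apply/fine_cvgP; split=> //; exact: nearW.
apply/cvgrPdist_le => delta delta0.
have sig0 : 0 <= variance_of G by apply: Rintegral_ge0 => k _; exact: sqr_ge0.
(* The sum of the three expectations in Markov's inequality, divided by [n] where
   the threshold is [A n]; in the second one [(1 - theta) n^2 = h]. *)
pose mass := mean_of G + h * mean_of G + 2 * variance_of G.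
have mass0 : 0 < mass by rewrite /mass ltr_wpDr ?mulr_ge0// ltr_wpDr// mulr_ge0// ltW.
(* [A] makes the three Markov bounds add up to [delta / 2]; [B] is what
   [h_ols_large] then requires. *)
pose A := 2 * mass / delta.
have A0 : 0 < A by rewrite divr_gt0// mulr_gt0.
pose B := (`|K| * A ^+ 2 + A + 2 * A ^+ 2 + A * mean_of G) / mean_of G.
have B0 : 0 <= B.
  have A_ge0 := ltW A0; have mu_ge0 := ltW mu0.
  apply: divr_ge0 => //.
  have A2 : 0 <= A ^+ 2 by exact: sqr_ge0.
  have KA2 : 0 <= `|K| * A ^+ 2 by exact: mulr_ge0.
  have Amu : 0 <= A * mean_of G by exact: mulr_ge0.
  by apply: addr_ge0 => //; apply: addr_ge0; [exact: addr_ge0|exact: mulr_ge0].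
have d2 : 0 < delta / 2 by rewrite divr_gt0.
have [n0 n0P] := anticoncentration eps ij gi gj B0 d2.
near=> n.
have nn0 : (n0 <= n)%N by near: n; exact: nbhs_infty_ge.
have npos : (0 < n)%N by near: n; exact: nbhs_infty_gt.
have theta01 : 0 <= 1 - h / n%:R ^+ 2 <= 1 by near: n; exact: theta_in_unit.
set Pn := P _.
have m := model _ theta01; rewrite -/Pn in m.
have nR : n%:R != 0 :> R by rewrite pnatr_eq0 -lt0n.
have := @prob_h_ols_gt _ _ _ Pn _ G Z eps n `|K| A B (delta / 2) (delta / 2) m theta01 G1 G2 mu0
  npos (normr_ge0 K) A0.
have KB : `|K| * A ^+ 2 + A + 2 * A ^+ 2 + A * mean_of G <= mean_of G * B.
  by rewrite /B [leRHS]mulrC divfK ?gt_eqF.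
have massE : mean_of G + (1 - (1 - h / n%:R ^+ 2)) * n%:R ^+ 2 * mean_of G +
    2 * variance_of G <= delta / 2 * A.
  rewrite le_eqVlt; apply/orP; left; apply/eqP; rewrite /A /mass.
  by field; rewrite nR gt_eqF.
have PW := n0P n nn0 Pn (innovation_indep m) (innovation_law m).
move=> /(_ KB massE PW); rewrite -splitr => lower.
have PE1 : (Pn (E n) <= 1)%E by apply: probability_le1; exact: measurable_h_ols_gt.
have lowerE : ((1 - delta)%:E <= Pn (E n))%E.
  apply: (le_trans lower); apply: le_measure; rewrite ?inE.
  - exact: measurable_h_ols_gt.
  - exact: measurable_h_ols_gt.
  - by move=> w /=; apply: le_lt_trans; exact: ler_norm.
have fE := finP n; rewrite -/Pn in fE.
rewrite -(fineK fE) lee_fin in PE1; rewrite -(fineK fE) lee_fin in lowerE.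
by rewrite ler_norml; apply/andP; split; lra.
Unshelve. all: by end_near.
Qed.
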